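(* Let $p,q$ be distinct primes, $n,m$ positive integers, $G=\mathrm{El}(p^n)\times\mathrm{El}(q^m)$, $\alpha=\frac{p^n-1}{p-1}$, $\beta=\frac{q^m-1}{q-1}$. Let \[ T_1=\begin{bmatrix} 0& p^n-1 & (p^n-1)(q^m-1) & q^m-1\\ 1& p-2 & (p-1)(q^m-1) & q^m-1\\ 1& p-1 & (p-1)(q-1)-1 & q-1\\ 1& p^n-1 & (p^n-1)(q-1) & q-2 \end{bmatrix}. \] Then the characteristic polynomial of the adjacency matrix of the enhanced power graph $\mathcal{G}_E(G)$ is \[ \phi_A(\mathcal{G}_E(G),x)=\phi(T_1,x)\,(x+1)^{p^nq^m-(\alpha+1)(\beta+1)}\,(x-pq+p+q)^{(\alpha-1)(\beta-1)} f(x)^{\alpha-1}g(x)^{\beta-1}, \] where $f(x)$ and $g(x)$ are the characteristic polynomials of $\begin{bmatrix} p-2 & (p-1)(q^m-1)\\ p-1 & (p-1)(q-1)-1\end{bmatrix}$ and $\begin{bmatrix}(p-1)(q-1)-1 & q-1\\ (p^n-1)(q-1) & q-2\end{bmatrix}$, respectively.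
   Context: $\mathrm{El}(p^n)$ denotes the elementary abelian group of order $p^n$. For a group $G$, the enhanced power graph $\mathcal{G}_E(G)$ is the simple graph with vertex set $G$ in which distinct $a,b$ are adjacent if and only if $a,b\in\langle c\rangle$ for some $c\in G$. $\phi(B,x)=\det(xI-B)$ and $\phi_A(\Gamma,x)$ is the characteristic polynomial of the adjacency matrix of $\Gamma$. *)

(* Defs.v *)
From HB Require Import structures.
From mathcomp Require Import all_boot all_order all_algebra all_fingroup all_solvable.

Set Implicit Arguments.
Unset Strict Implicit.
Unset Printing Implicit Defensive.

Import GRing.Theory.
Local Open Scope ring_scope.

Record sgraph := SGraph {
  vertex : finType;
  adj : rel vertex;
  adj_sym : symmetric adj;
  adj_irr : irreflexive adj }.

Definition adjacency_mx (R : nzRingType) (Gamma : sgraph) :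
    'M[R]_#|vertex Gamma| :=
  \matrix_(i, j) (adj (enum_val i) (enum_val j))%:R.

Definition adj_char_poly (R : nzRingType) (Gamma : sgraph) : {poly R} :=
  char_poly (adjacency_mx R Gamma).

Section EnhancedPowerGraph.

Variables (gT : finGroupType) (G : {group gT}).

Definition epg_adj : rel [subg G] := fun a b =>
  (a != b) && [exists c : [subg G], (a \in <[c]>%g) && (b \in <[c]>%g)].

Lemma epg_adj_sym : symmetric epg_adj.
Proof.
move=> a b; rewrite /epg_adj eq_sym; congr (_ && _).
by apply: eq_existsb => c; rewrite andbC.
Qed.

Lemma epg_adj_irr : irreflexive epg_adj.
Proof. by move=> a; rewrite /epg_adj eqxx. Qed.

Definition enhanced_power_graph : sgraph := SGraph epg_adj_sym epg_adj_irr.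

End EnhancedPowerGraph.

(* The elementary abelian group of order [p ^ n] is unique only up to
   isomorphism, hence a predicate. *)
Definition is_El (p n : nat) (gT : finGroupType) (A : {group gT}) : Prop :=
  (p.-abelem A)%g /\ #|A| = (p ^ n)%N.

Definition rows_mx (R : nzRingType) (m n : nat) (rows : seq (seq R)) :
    'M[R]_(m, n) :=
  \matrix_(i, j) (nth [::] rows i)`_j.

Section QuotientMatrices.

Variables (R : nzRingType) (p q n m : nat).

Local Notation P := (p%:R : R).
Local Notation Q := (q%:R : R).

Definition T1 : 'M[R]_4 := rows_mx 4 4
  [:: [:: 0; P ^+ n - 1; (P ^+ n - 1) * (Q ^+ m - 1); Q ^+ m - 1];
      [:: 1; P - 2;      (P - 1) * (Q ^+ m - 1);      Q ^+ m - 1];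
      [:: 1; P - 1;      (P - 1) * (Q - 1) - 1;       Q - 1];
      [:: 1; P ^+ n - 1; (P ^+ n - 1) * (Q - 1);      Q - 2]].

Definition Mf : 'M[R]_2 := rows_mx 2 2
  [:: [:: P - 2; (P - 1) * (Q ^+ m - 1)];
      [:: P - 1; (P - 1) * (Q - 1) - 1]].

Definition Mg : 'M[R]_2 := rows_mx 2 2
  [:: [:: (P - 1) * (Q - 1) - 1;  Q - 1];
      [:: (P ^+ n - 1) * (Q - 1); Q - 2]].

End QuotientMatrices.

(* Main.v *)
(** Write [J(H)] for the 0-1 matrix of the relation "[x] and [y] lie in a common
    cyclic subgroup of [H]", so that the adjacency matrix of the enhanced power
    graph of [H] is [J(H) - 1].  As [|A|] and [|B|] are coprime,
    [J(A x B)] is the Kronecker product of [J(A)] and [J(B)], and its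
    eigenvalues are the products of an eigenvalue of [J(A)] and one of [J(B)].  For
    [A = El(p^n)], [J(A)] is the matrix of an equivalence relation with [alpha]
    classes of size [p - 1], bordered by a row and a column of ones; its
    eigenvalues are [0], [p - 1] with multiplicity [alpha - 1], and those of
    [[1, p^n - 1], [1, p - 1]].  The matrix [T1 + 1] is the Kronecker product of
    the two 2x2 matrices so obtained for [A] and [B], up to the order of the
    indices, and [f], [g] collect the products involving [p - 1] or [q - 1].
    Eigenvalues are taken in [algC]; both sides have integer coefficients, which
    gives the result over [R]. *)
Require Import Defs.
From HB Require Import structures.
From mathcomp Require Import all_boot all_order all_algebra all_fingroup all_solvable.
From mathcomp Require Import algC spectral ring.
From mathcomp.real_closed Require Import mxtens.

Set Implicit Arguments.
Unset Strict Implicit.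
Unset Printing Implicit Defensive.

Import GRing.Theory Num.Theory.
Local Open Scope ring_scope.

(** * Characteristic polynomials under reindexing, commutation and shift *)

(** Rows and columns undergo the same permutation, so the two signs cancel. The sizes may be
    different expressions, such as a cardinal and a product. *)
Lemma char_poly_reindex (R : comNzRingType) n n' (M : 'M[R]_n) (M' : 'M[R]_n')
    (g : 'I_n -> 'I_n') :
  bijective g -> (forall i j, M i j = M' (g i) (g j)) ->
  char_poly M = char_poly M'.
Proof.
move=> bij_g; have en := bij_eq_card bij_g; rewrite !card_ord in en.
case: _ / en in M' g bij_g * => eM; have inj_g := bij_inj bij_g.
rewrite /char_poly; suff -> : char_poly_mx M
    = row_perm (perm inj_g) (col_perm (perm inj_g) (char_poly_mx M')).
  rewrite row_permE col_permE !det_mulmx !det_perm odd_permV.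
  by rewrite mulrCA -signr_addb addbb mulr1.
by apply/matrixP=> i j; rewrite !mxE !permE eM (inj_eq inj_g).
Qed.

(** The matrix [[[X, U], [V, 1]]] is made block triangular in two ways, by right multiplication with
    [[[1, 0], [-V, 1]]] and with [[[1, -U], [0, X]]]; the latter has determinant [X^k]. *)
Lemma char_poly_mulC_rect (R : comNzRingType) n k
    (U : 'M[R]_(n, k)) (V : 'M_(k, n)) :
  char_poly (U *m V) * 'X^k = 'X^n * char_poly (V *m U).
Proof.
pose u := map_mx polyC U; pose v := map_mx polyC V.
have <- : \det (block_mx 'X%:M u v 1%:M) = char_poly (U *m V).
  rewrite -[LHS]mulr1 -[X in _ * X](_ : \det (block_mx 1%:M 0 (- v) 1%:M) = 1).
    rewrite -det_mulmx mulmx_block !mulmx1 !mulmx0 mul1mx subrr mulmxN det_ublock.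
    by rewrite add0r det1 mulr1 -map_mxM.
  by rewrite det_lblock !det1 mulr1.
rewrite -(det_scalar k 'X) -(det_scalar n 'X).
rewrite -[X in _ * X]mul1r -[X in _ * (X * _)](det1 _ n) -(det_ublock 1%:M (- u)).
rewrite -det_mulmx mulmx_block !mulmx1 !mulmx0 !mul1mx !mulmxN !addr0.
rewrite mul_scalar_mx mul_mx_scalar addNr det_lblock.
by rewrite /char_poly /char_poly_mx map_mxM addrC.
Qed.

Lemma char_poly_mulC (R : idomainType) n (U V : 'M[R]_n) :
  char_poly (U *m V) = char_poly (V *m U).
Proof.
apply: (@mulfI _ 'X^n); first by rewrite -size_poly_eq0 size_polyXn.
by rewrite mulrC char_poly_mulC_rect.
Qed.

Lemma char_poly_subr1 (R : comNzRingType) n (M : 'M[R]_n) :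
  char_poly (M - 1%:M) = char_poly M \Po ('X + 1).
Proof.
rewrite -[RHS]/((comp_poly ('X + 1)) (char_poly M)) -det_map_mx; congr (\det _).
apply/matrixP=> i j; rewrite !mxE.
rewrite polyCB /= comp_polyB comp_polyC; case: eqP => _.
  by rewrite !mulr1n comp_polyX polyC1; ring.
by rewrite !mulr0n comp_poly0 polyC0 subr0.
Qed.

(** * Spectrum of a Kronecker product *)

(** Pairs of indices are ordered lexicographically: above the diagonal, either the first indices
    increase, or they agree and the second ones increase. *)
Lemma is_trig_mx_tens (R : comNzRingType) m n (A : 'M[R]_m) (B : 'M[R]_n) :
  is_trig_mx A -> is_trig_mx B -> is_trig_mx (tensmx A B).
Proof.
move=> /is_trig_mxP trigA /is_trig_mxP trigB; apply/is_trig_mxP=> i j.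
case: (mxtens_indexP i) => i1 i2; case: (mxtens_indexP j) => j1 j2.
rewrite tensmxE /= => lt_ij; case: (ltngtP i1 j1) => [lt1|gt1|/val_inj eq1].
- by rewrite trigA ?mul0r.
- suff: false by []; rewrite -(ltnn (i1 * n + i2)) (ltn_trans lt_ij) //.
  rewrite (@leq_trans (j1.+1 * n)) //; first by rewrite mulSnr ltn_add2l.
  by rewrite (leq_trans (leq_mul gt1 (leqnn n))) ?leq_addr.
by move: lt_ij; rewrite eq1 ltn_add2l => lt2; rewrite trigB ?mulr0.
Qed.

Lemma eigenvalues_trig (C : numClosedFieldType) n (A : 'M[C]_n) (s : seq C) :
    (n > 0)%N -> char_poly A = \prod_(a <- s) ('X - a%:P) ->
  exists P T : 'M[C]_n,
    [/\ P \in unitmx, is_trig_mx T, A = invmx P *m T *m P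
      & perm_eq [seq T i i | i <- enum 'I_n] s].
Proof.
move=> n_gt0 eA; have [P /unitarymx_unit Pu trigP] := Schur A n_gt0.
exists P, (conjmx P A); rewrite conjumx //.
have trigT : is_trig_mx (P *m A *m invmx P) by rewrite -conjumx.
split=> //; first by rewrite !mulmxA mulVmx // mul1mx mulmxKV.
apply: prod_XsubC_eq; rewrite -eA big_map big_enum /= -char_poly_trig //.
by rewrite char_poly_mulC mulmxA mulVmx // mul1mx.
Qed.

(* By Schur triangularization: the diagonal of a Kronecker product of triangular
   matrices lists the products of the diagonal entries. *)
Lemma char_poly_tensmx (C : numClosedFieldType) m n (A : 'M[C]_m) (B : 'M[C]_n)
    (s t : seq C) :
    (m > 0)%N -> (n > 0)%N ->
    char_poly A = \prod_(a <- s) ('X - a%:P) ->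
    char_poly B = \prod_(b <- t) ('X - b%:P) ->
  char_poly (tensmx A B) = \prod_(a <- s) \prod_(b <- t) ('X - (a * b)%:P).
Proof.
move=> m_gt0 n_gt0 /(eigenvalues_trig m_gt0)[P [S [Pu trigS -> eS]]].
move=> /(eigenvalues_trig n_gt0)[Q [T [Qu trigT -> eT]]].
rewrite -!tensmx_mul char_poly_mulC !mulmxA tensmx_mul !mulmxV // tensmx_mul.
rewrite !mul1mx char_poly_trig ?is_trig_mx_tens // -(perm_big _ eS) big_map big_enum /=.
under [RHS]eq_bigr => i _ do rewrite -(perm_big _ eT) big_map big_enum /=.
rewrite pair_big /= (reindex (@mxtens_index m n)) /=.
  by apply: eq_bigr => -[i j] _; rewrite tensmxE.
by exists (@mxtens_unindex m n) => i _; rewrite (mxtens_indexK, mxtens_unindexK).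
Qed.

(** * Equivalence relations and cones over them *)

(* The matrix of an equivalence relation is [U *m U^T], with [U] the incidence
   matrix between elements and classes, whereas [U^T *m U] is scalar. *)
Lemma char_poly_equiv (R : idomainType) n (T : finType) (C : {set T})
    (h : 'I_n -> T) d :
    (forall i, h i \in C) -> {in C, forall c, #|[set i | h i == c]| = d} ->
  char_poly (\matrix_(i, j) (h i == h j)%:R : 'M[R]_n) * 'X^#|C|
    = 'X^n * ('X - d%:R%:P) ^+ #|C|.
Proof.
move=> hC hd; pose U : 'M[R]_(n, #|C|) := \matrix_(i, j) (h i == enum_val j)%:R.
have -> : \matrix_(i, j) (h i == h j)%:R = U *m U^T.
  apply/matrixP=> i j; rewrite !mxE.
  rewrite (bigD1 (enum_rank_in (hC i) (h i))) //= !mxE enum_rankK_in // eqxx.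
  rewrite mul1r eq_sym big1 ?addr0 // => k nk; rewrite !mxE.
  case: eqP => [ek|_]; last by rewrite mul0r.
  by case/eqP: nk; apply: enum_val_inj; rewrite enum_rankK_in // ek.
rewrite char_poly_mulC_rect; congr (_ * _).
have -> : U^T *m U = d%:R%:M.
  apply/matrixP=> i j; rewrite !mxE.
  under eq_bigr => k _ do rewrite !mxE -natrM mulnb.
  rewrite -natr_sum; have [<-|nij] := eqVneq i j.
    rewrite mulr1n -(hd _ (enum_valP i)); congr _%:R.
    rewrite -sum1_card [RHS]big_mkcond /=.
    by apply: eq_bigr => k _; rewrite inE andbb; case: eqP.
  rewrite mulr0n big1 // => k _; case: eqP => //= ->.
  by rewrite (inj_eq enum_val_inj) (negPf nij).
by rewrite /char_poly /char_poly_mx map_scalar_mx /= -raddfB /= det_scalar.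
Qed.

(* Since the rows of [E] sum to [d], the first column of [X - M] times [X - d],
   plus the sum of the other columns, vanishes below the corner. *)
Lemma char_poly_cone (R : comNzRingType) n (E : 'M[R]_n) d :
    (forall i, \sum_j E i j = d) ->
  char_poly (block_mx (1%:M : 'M_1) (const_mx 1) (const_mx 1) E) * ('X - d%:P)
    = (('X - 1) * ('X - d%:P) - n%:R%:P) * char_poly E.
Proof.
move=> sumE; set M := block_mx _ _ _ _.
have {1}-> : 'X - d%:P =
    \det (block_mx ('X - d%:P)%:M 0 (const_mx 1) 1%:M : 'M_(1 + n)).
  by rewrite det_lblock det1 mulr1 det_scalar1.
rewrite /char_poly -det_mulmx /char_poly_mx map_block_mx /= !map_const_mx.
rewrite map_scalar_mx /= polyC1 scalar_mx_block opp_block_mx add_block_mx.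
rewrite mulmx_block !mulmx1 !mulmx0 !add0r.
set D := (D in block_mx _ _ D _); have -> : D = 0.
  apply/matrixP=> i j; rewrite ord1 !mxE big_ord1 !mxE mulr1n.
  under eq_bigr => k _ do rewrite !mxE mulr1 mulrb.
  rewrite big_split /= (bigD1 i) //= eqxx big1 => [|k /negPf]; last first.
    by rewrite eq_sym => ->.
  by rewrite sumrN -rmorph_sum sumE /= addr0 mulN1r addNr.
rewrite det_ublock; congr (_ * _).
rewrite -raddfB /= -scalar_mxM det_mx11 !mxE mulr1n; congr (_ + _).
under eq_bigr => k _ do rewrite !mxE mulr1.
by rewrite sumr_const card_ord mulNrn rmorph_nat.
Qed.

(** * Common cyclic subgroups in elementary abelian groups and direct products *)

Lemma card_subg (gT : finGroupType) (G : {group gT}) : #|[subg G]| = #|G|.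
Proof. by rewrite (card_isog (isog_subg G)) cardsT. Qed.

(** The relation behind [J(H)]. Unlike adjacency it holds on the diagonal, which lets it factor over
    coprime direct products. *)
Definition cocyclic (gT : finGroupType) (G : {set gT}) : rel gT :=
  fun x y => [exists c in G, (x \in <[c]>%g) && (y \in <[c]>%g)].

Definition cocyclic_mx (R : nzRingType) (gT : finGroupType) (G : {group gT}) :
    'M[R]_#|[subg G]| :=
  \matrix_(i, j) (cocyclic G (sgval (enum_val i)) (sgval (enum_val j)))%:R.

(** Nontrivial cyclic subgroups all have order [p], so an inclusion between two of them is an
    equality. *)
Lemma abelem_cycle_eq p (gT : finGroupType) (A : {group gT}) x y :
    (p.-abelem A)%g -> y \in A -> x \in (<[y]>^#)%g -> <[x]>%g = <[y]>%g.
Proof.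
move=> abA Ay /setD1P[x1 xy]; apply/eqP; rewrite eqEcard cycle_subG xy /=.
have sYA : (<[y]> \subset A)%g by rewrite cycle_subG.
have [y1|y1] := eqVneq y 1%g; first by rewrite y1 cycle1 cards1 cardG_gt0.
by rewrite -!orderE !(abelem_order_p abA) // (subsetP sYA).
Qed.

Lemma cocyclic_abelem p (gT : finGroupType) (A : {group gT}) :
    (p.-abelem A)%g ->
  {in A &, forall x y,
    cocyclic A x y = [|| x == 1%g, y == 1%g | <[x]>%g == <[y]>%g]}.
Proof.
move=> abA x y Ax Ay; apply/exists_inP/idP=> [[c Ac /andP[xc yc]]|].
  have [//|x1] := eqVneq x 1%g; have [//|y1] := eqVneq y 1%g.
  by rewrite !(abelem_cycle_eq abA Ac) ?eqxx ?inE ?x1 ?y1.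
case/or3P=> [/eqP->|/eqP->|/eqP exy].
- by exists y; rewrite ?group1 ?cycle_id.
- by exists x; rewrite ?group1 ?cycle_id.
- by exists x; rewrite // {2}exy !cycle_id.
Qed.

(** Here [k.+1] is [alpha], the number of subgroups of order [p]. The identity is the apex of a cone
    over the equivalence relation of generating the same subgroup. *)
Lemma char_poly_cocyclic_abelem (R : idomainType) p n (gT : finGroupType)
    (A : {group gT}) :
    prime p -> (0 < n)%N -> (p.-abelem A)%g -> #|A| = (p ^ n)%N ->
  exists2 k, (p ^ n - 1 = k.+1 * (p - 1))%N &
  char_poly (cocyclic_mx R A)
    = 'X^(p ^ n - 1 - k.+1) * ('X - (p - 1)%:R%:P) ^+ k
      * (('X - 1) * ('X - (p - 1)%:R%:P) - (p ^ n - 1)%:R%:P).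
Proof.
move=> p_pr n_gt0 abA cardA; have p_gt1 := prime_gt1 p_pr.
set N := (p ^ n - 1)%N; set d := (p - 1)%N.
have cardN : #|A^#%g| = N by rewrite /N -cardA (cardsD1 1%g A) group1 addKn.
pose x_ (i : 'I_N) : gT := enum_val (cast_ord (esym cardN) i).
have x_A i : x_ i \in A^#%g by apply: enum_valP.
have x_inj : injective x_ by move=> i j /enum_val_inj/cast_ord_inj.
have x_surj x : x \in A^#%g -> exists i, x = x_ i.
  move=> Ax; exists (cast_ord cardN (enum_rank_in Ax x)).
  by rewrite /x_ cast_ordK enum_rankK_in.
pose C := [set <[x]>%g | x in A^#%g]; pose h i := <[x_ i]>%g.
have hC i : h i \in C by apply: imset_f.
(* A subgroup of order [p] is generated by each of its [p - 1] nontrivial elements. *)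
have hd : {in C, forall c, #|[set i | h i == c]| = d}.
  move=> _ /imsetP[x Ax ->]; have /setD1P[x1 Gx] := Ax.
  rewrite -(card_imset _ x_inj) /d -(abelem_order_p abA Gx x1) orderE.
  rewrite (cardsD1 1%g <[x]>%g) group1 addKn; congr #|pred_of_set _|.
  apply/setP=> y; apply/imsetP/idP=> [[i] | yx].
    rewrite inE => /eqP hi ->; have /setD1P[y1 _] := x_A i.
    by rewrite !inE y1 -hi cycle_id.
  have /setD1P[y1 yx'] := yx.
  have [i ey] : exists i, y = x_ i.
    by apply: x_surj; rewrite !inE y1 (subsetP _ _ yx') // cycle_subG.
  by exists i; rewrite // inE /h -ey (abelem_cycle_eq abA Gx yx).
have NC : (N = #|C| * d)%N.
  rewrite -sum_nat_const -[LHS]card_ord -sum1_card (partition_big h (mem C)) //=.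
  by apply: eq_bigr => c /hd <-; rewrite -sum1_card; apply: eq_bigl => i; rewrite inE.
have N_gt0 : (0 < N)%N by rewrite subn_gt0 -{1}(expn0 p) ltn_exp2l.
have d_gt0 : (0 < d)%N by rewrite subn_gt0.
have C_gt0 : (0 < #|C|)%N by move: N_gt0; rewrite NC muln_gt0 => /andP[].
exists #|C|.-1; rewrite prednK //.
pose E : 'M[R]_N := \matrix_(i, j) (h i == h j)%:R.
have sumE i : \sum_j E i j = d%:R.
  under eq_bigr => j _ do rewrite mxE eq_sym.
  rewrite -natr_sum -(hd _ (hC i)) -sum1_card [in RHS]big_mkcond /=.
  by congr _%:R; apply: eq_bigr => j _; rewrite inE; case: eqP.
(* Listing the identity first puts the matrix in the block form of a cone. *)
pose elt (i : 'I_(1 + N)) := if split i is inr j then x_ j else 1%g.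
have eltA i : elt i \in A.
  rewrite /elt; case: splitP => j _;
  by rewrite ?group1 // (subsetP (subD1set A 1%g)).
have elt_inj : injective elt.
  move=> i j; rewrite /elt => eij; rewrite -[i]splitK -[j]splitK; move: eij.
  case: (split i) (split j) => [i'|i'] [j'|j'] //= eij.
  - by rewrite !ord1.
  - by have := x_A j'; rewrite -eij !inE eqxx.
  - by have := x_A i'; rewrite eij !inE eqxx.
  - by rewrite (x_inj _ _ eij).
pose g i := enum_rank (subg A (elt i)).
have bij_g : bijective g.
  apply: inj_card_bij => [i j /enum_rank_inj|].
    by move/(congr1 val); rewrite /= !subgK // => /elt_inj.
  by rewrite !card_ord card_subg cardA /N add1n subn1 prednK ?expn_gt0 ?prime_gt0.
pose M := block_mx (1%:M : 'M_1) (const_mx 1) (const_mx 1) E.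
rewrite -(char_poly_reindex (M := M) bij_g); last first.
  move=> i j; rewrite !mxE !enum_rankK !subgK // (cocyclic_abelem abA) // /elt.
  case: (split i) => i'; rewrite !mxE; case: (split j) => j';
    rewrite !mxE ?eqxx ?orbT //=.
    by rewrite !ord1 eqxx.
  by have /setD1P[/negPf-> _] := x_A i'; have /setD1P[/negPf-> _] := x_A j'.
(* The cone formula carries an extra factor [X - d] and the equivalence formula an extra [X^#|C|].
   Cancelling the former lowers the multiplicity of [d] from [#|C|] to [#|C| - 1]. *)
have Xd_neq0 : 'X - d%:R%:P != 0 :> {poly R} by rewrite polyXsubC_eq0.
have XC_neq0 : 'X^#|C| != 0 :> {poly R} by rewrite -size_poly_eq0 size_polyXn.
apply: (mulIf Xd_neq0); apply: (mulIf XC_neq0); rewrite (char_poly_cone sumE).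
rewrite -[LHS]mulrA (char_poly_equiv _ hC hd).
have -> : 'X^N = 'X^(N - #|C|) * 'X^#|C| :> {poly R}.
  by rewrite -exprD subnK // NC leq_pmulr.
have -> :
  ('X - d%:R%:P) ^+ #|C| = ('X - d%:R%:P) * ('X - d%:R%:P) ^+ #|C|.-1 :> {poly R}.
  by rewrite -exprS prednK.
suff mulACA (a b c u w : {poly R}) : w * (a * b * (u * c)) = a * c * w * u * b.
  exact: mulACA.
by ring.
Qed.

(** Powers are taken componentwise, so cyclic subgroups project to cyclic subgroups. Conversely,
    when [a] and [b] have coprime orders, the Chinese remainder theorem yields one exponent of
    [(a, b)] that realizes given powers of both. *)
Lemma cocyclic_setX (aT bT : finGroupType) (A : {group aT}) (B : {group bT}) :
    coprime #|A| #|B| ->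
  {in setX A B &, forall x y,
    cocyclic (setX A B) x y = cocyclic A x.1 y.1 && cocyclic B x.2 y.2}.
Proof.
move=> coAB x y _ _.
have pairX (a : aT) (b : bT) k : ((a, b) ^+ k = (a ^+ k, b ^+ k))%g.
  by elim: k => // k IHk; rewrite !expgS IHk.
apply/exists_inP/andP=> [[[a b]]|[]].
  rewrite inE /= => /andP[Aa Bb] /andP[/cycleP[i ->] /cycleP[j ->]].
  by split; apply/exists_inP; [exists a | exists b]; rewrite // !pairX !mem_cycle.
move=> /exists_inP[a Aa /andP[xa ya]] /exists_inP[b Bb /andP[xb yb]].
exists (a, b); rewrite ?inE ?Aa //.
suff H z : z.1 \in <[a]>%g -> z.2 \in <[b]>%g -> z \in <[(a, b)]>%g by rewrite !H.
case: z => _ _ /= /cycleP[i ->] /cycleP[j ->].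
have coab : coprime #[a]%g #[b]%g.
  by rewrite (coprime_dvdl _ (coprime_dvdr _ coAB)) // order_dvdG.
apply/cycleP; exists (chinese #[a]%g #[b]%g i j); rewrite pairX.
by congr (_, _); apply/eqP; rewrite eq_expg_mod_order ?chinese_modl ?chinese_modr.
Qed.

Lemma cocyclic_isom (gT hT : finGroupType) (G : {group gT}) (H : {group hT})
    (f : {morphism G >-> hT}) :
    isom G H f ->
  {in G &, forall x y, cocyclic G x y = cocyclic H (f x) (f y)}.
Proof.
move=> /isomP[injf <-] x y Gx Gy; apply/exists_inP/exists_inP.
  case=> c Gc xyc; exists (f c); first by rewrite mem_morphim.
  have sc : (<[c]> \subset G)%g by rewrite cycle_subG.
  by rewrite -morphim_cycle // !mem_morphim // ?(subsetP sc); case/andP: xyc.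
case=> _ /morphimP[c _ Gc ->]; rewrite -morphim_cycle // => xyc; exists c => //.
have inj z : z \in G -> f z \in (f @* <[c]>)%g -> z \in <[c]>%g.
  by move=> Gz /morphimP[w Gw cw /(injmP injf _ _ Gz Gw) ->].
by case/andP: xyc => /inj-> // /inj->.
Qed.

Lemma char_poly_cocyclic_mx_setX (R : comNzRingType) (aT bT gT : finGroupType)
    (A : {group aT}) (B : {group bT}) (G : {group gT}) :
    coprime #|A| #|B| -> G \isog setX A B ->
  char_poly (cocyclic_mx R G)
    = char_poly (tensmx (cocyclic_mx R A) (cocyclic_mx R B)).
Proof.
move=> coAB /isog_isom[f isof]; have /isomP[injf imf] := isof.
pose u i := f (sgval (@enum_val [subg G] predT i)).
have uAB i : u i \in setX A B by rewrite -imf mem_morphim ?subgP.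
have uA i : (u i).1 \in A by have := uAB i; rewrite inE => /andP[].
have uB i : (u i).2 \in B by have := uAB i; rewrite inE => /andP[].
(* An element of [G] is sent to the pair of coordinates of its image under the isomorphism. *)
pose g i := mxtens_index (enum_rank (subg A (u i).1), enum_rank (subg B (u i).2)).
apply: (char_poly_reindex (g := g)) => [|i j].
  apply: inj_card_bij => [i j /(can_inj (@mxtens_indexK _ _))[]|].
    move=> /enum_rank_inj/(congr1 val); rewrite /= !subgK // => e1.
    move=> /enum_rank_inj/(congr1 val); rewrite /= !subgK // => e2.
    have: u i = u j by rewrite [u i]surjective_pairing e1 e2 -surjective_pairing.
    by move/(injmP injf _ _ (subgP _) (subgP _))/subg_inj/enum_val_inj.
  by rewrite !card_ord !card_subg -cardsX -imf card_injm.
rewrite tensmxE !mxE !enum_rankK /= !subgK // (cocyclic_isom isof) ?subgP //.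
by have := cocyclic_setX coAB (uAB i) (uAB j); rewrite /u => ->; rewrite -natrM mulnb.
Qed.

Lemma adjacency_enhanced_power_graph (R : nzRingType) (gT : finGroupType)
    (G : {group gT}) :
  adjacency_mx R (enhanced_power_graph G) = cocyclic_mx R G - 1%:M.
Proof.
apply/matrixP=> i j; rewrite !mxE /= /epg_adj (inj_eq enum_val_inj).
rewrite -(cocyclic_isom (isom_sgval G)) ?inE //.
have [->|_] := eqVneq i j; last first.
  by rewrite subr0 /=; congr (nat_of_bool _)%:R; apply: eq_existsb => c; rewrite inE.
suff -> : cocyclic [subg G]%g (enum_val j) (enum_val j) by rewrite subrr.
by apply/exists_inP; exists (enum_val j); rewrite ?inE ?cycle_id.
Qed.

(** * Quadratic factors and products of eigenvalues *)

Lemma char_poly_mx22 (R : comNzRingType) (M : 'M[R]_2) :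
  char_poly M
    = ('X - (M 0 0)%:P) * ('X - (M 1 1)%:P) - (M 0 1 * M 1 0)%:P.
Proof.
rewrite /char_poly (expand_det_row _ 0) !big_ord_recl big_ord0 /cofactor.
rewrite !det_mx11 !mxE /= !mulr1n !mulr0n.
have lift0 : lift 0 0 = 1 :> 'I_2 by apply: val_inj.
have lift1 : lift 1 0 = 0 :> 'I_2 by apply: val_inj.
by rewrite -[ord0]/(0 : 'I_2) -[ord0 : 'I_1]/(0 : 'I_1) !lift0 lift1 rmorphM; ring.
Qed.

Lemma quadratic_roots (C : numClosedFieldType) (s t : C) :
  exists a b, a + b = s /\ a * b = t.
Proof.
have two0 : 2 != 0 :> C by rewrite pnatr_eq0.
pose r := sqrtC (s ^+ 2 - 4 * t); exists ((s + r) / 2), ((s - r) / 2).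
have er : r ^+ 2 = s ^+ 2 - 4 * t by rewrite sqrtCK.
split; first by field.
apply: (@mulfI _ 4); first by rewrite pnatr_eq0.
transitivity (s ^+ 2 - r ^+ 2); first by field.
by rewrite er; ring.
Qed.

(** The exponent of [X] counts pairs with a listed zero: [u] zeros against all [v + l.+2] values on
    the right, then the [k.+2] other values against [v] zeros. *)
Lemma prod_XsubC_pairs (R : comNzRingType) (u v k l : nat) (d e a1 a2 b1 b2 : R) :
  \prod_(a <- nseq u 0 ++ nseq k d ++ [:: a1; a2])
    \prod_(b <- nseq v 0 ++ nseq l e ++ [:: b1; b2]) ('X - (a * b)%:P)
  = \prod_(a <- [:: a1; a2]) \prod_(b <- [:: b1; b2]) ('X - (a * b)%:P)
    * 'X^(u * (v + l.+2) + k.+2 * v)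
    * ('X - (d * e)%:P) ^+ (k * l)
    * (('X - (d * b1)%:P) * ('X - (d * b2)%:P)) ^+ k
    * (('X - (a1 * e)%:P) * ('X - (a2 * e)%:P)) ^+ l.
Proof.
pose F a : {poly R} :=
  'X^v * ('X - (a * e)%:P) ^+ l * (('X - (a * b1)%:P) * ('X - (a * b2)%:P)).
under eq_bigr => a _ do
  rewrite !big_cat !big_nseq !iter_mulr_1 /= !big_cons big_nil mulr1 mulr0
    subr0 mulrA -/(F a).
rewrite !big_cat !big_nseq !iter_mulr_1 /= !big_cons !big_nil !mulr1.
have -> : F 0 = 'X^(v + l.+2) by rewrite /F !mul0r subr0 -expr2 -!exprD -addnA addn2.
rewrite /F -!exprM (mulnC _ u) !mulSn !(exprD _ (u * _)) !(exprD _ v).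
rewrite !exprMn -!exprM (mulnC v) (mulnC l).
move: ('X^(u * _)) ('X^(k * v)) ('X^v) (_ ^+ (k * l)) => x1 x2 x3 x4.
move: (('X - (a1 * e)%:P) ^+ l) (('X - (a2 * e)%:P) ^+ l) => y1 y2.
move: (('X - (d * b1)%:P) ^+ k) (('X - (d * b2)%:P) ^+ k) => z1 z2.
move: ('X - (a1 * b1)%:P) ('X - (a1 * b2)%:P) => t1 t2.
move: ('X - (a2 * b1)%:P) ('X - (a2 * b2)%:P) => t3 t4.
by ring.
Qed.

(** * Change of base ring *)

Lemma map_rows_mx (R S : nzRingType) (f : {rmorphism R -> S}) m n
    (rows : seq (seq R)) :
  map_mx f (rows_mx m n rows) = rows_mx m n (map (map f) rows).
Proof.
apply/matrixP=> i j; rewrite !mxE.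
have [ltis|leis] := ltnP i (size rows); last first.
  by rewrite !(nth_default [::]) ?size_map // !nth_nil rmorph0.
rewrite (nth_map [::]) //; have [ltjs|lejs] := ltnP j (size (nth [::] rows i)).
  by rewrite (nth_map 0).
by rewrite (nth_default 0 lejs) [RHS]nth_default ?size_map ?rmorph0.
Qed.

(** The claimed value over any commutative ring, named so that it can be transported along ring
    morphisms. *)
Definition epg_poly (R : comNzRingType) (p q n m alpha beta : nat) : {poly R} :=
  char_poly (T1 R p q n m)
    * ('X + 1) ^+ (p ^ n * q ^ m - (alpha + 1) * (beta + 1))
    * ('X - (p * q)%:R%:P + p%:R%:P + q%:R%:P) ^+ ((alpha - 1) * (beta - 1))
    * char_poly (Mf R p q m) ^+ (alpha - 1) * char_poly (Mg R p q n) ^+ (beta - 1).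

Lemma map_epg_poly (R S : comNzRingType) (f : {rmorphism R -> S})
    p q n m alpha beta :
  map_poly f (epg_poly R p q n m alpha beta) = epg_poly S p q n m alpha beta.
Proof.
have eT : map_mx f (T1 R p q n m) = T1 S p q n m.
  rewrite map_rows_mx /=.
  by rewrite !(rmorphM, rmorphB, rmorphXn, rmorph_nat, rmorph0, rmorph1).
have eF : map_mx f (Mf R p q m) = Mf S p q m.
  rewrite map_rows_mx /=.
  by rewrite !(rmorphM, rmorphB, rmorphXn, rmorph_nat, rmorph0, rmorph1).
have eG : map_mx f (Mg R p q n) = Mg S p q n.
  rewrite map_rows_mx /=.
  by rewrite !(rmorphM, rmorphB, rmorphXn, rmorph_nat, rmorph0, rmorph1).
rewrite /epg_poly -eT -eF -eG -!map_char_poly.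
rewrite !(rmorphM, rmorphXn) /= !(rmorphD, rmorphB, rmorphXn) /=.
by rewrite !map_polyC /= map_polyX rmorph1 !rmorph_nat rmorphN rmorphM /= !rmorph_nat.
Qed.

Lemma map_adj_char_poly (R S : comNzRingType) (f : {rmorphism R -> S}) Gamma :
  map_poly f (adj_char_poly R Gamma) = adj_char_poly S Gamma.
Proof.
rewrite /adj_char_poly map_char_poly; congr char_poly.
by apply/matrixP=> i j; rewrite !mxE rmorph_nat.
Qed.

(** * Quotient matrices *)

(** With [d = p - 1] and [N = p^n - 1], this is the quotient of [J(A)] by the partition into the
    identity and the rest. *)
Definition quotient_mx (R : nzRingType) (d N : R) : 'M[R]_2 :=
  rows_mx 2 2 [:: [:: 1; N]; [:: 1; d]].

(** The left side is the characteristic polynomial of [quotient_mx d N], of trace [1 + d] and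
    determinant [d - N]. *)
Lemma quadratic_factor (R : comNzRingType) (d N a1 a2 : R) :
    a1 + a2 = 1 + d -> a1 * a2 = d - N ->
  ('X - 1) * ('X - d%:P) - N%:P = ('X - a1%:P) * ('X - a2%:P).
Proof.
move=> sa ta; have -> : N = d - a1 * a2 by rewrite ta; ring.
have -> : d = a1 + a2 - 1 by rewrite sa; ring.
by rewrite !(rmorphD, rmorphN, rmorphM, rmorph1); ring.
Qed.

Lemma char_poly_T1 (R : comNzRingType) p q n m :
  char_poly (T1 R p q n m) =
    char_poly (tensmx (quotient_mx (p%:R - 1) (p%:R ^+ n - 1))
                      (quotient_mx (q%:R - 1) (q%:R ^+ m - 1)) : 'M[R]_(2 * 2))
    \Po ('X + 1).
Proof.
(* The rows of [T1] stand for the identity, then the elements whose nontrivial components are the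
   first only, both, the second only. *)
pose g (i : 'I_4) : 'I_(2 * 2) := mxtens_index
  (tnth [tuple (0 : 'I_2, 0 : 'I_2); (1, 0); (1, 1); (0, 1)] i).
rewrite -[T1 R p q n m](addrK 1%:M) char_poly_subr1; congr (_ \Po _).
apply: (char_poly_reindex (g := g)) => [|i j].
  apply: inj_card_bij => [i j|]; last by rewrite !card_ord.
  move=> /(can_inj (@mxtens_indexK _ _)).
  by case: i => [[|[|[|[|[]]]]] ?] //; case: j => [[|[|[|[|[]]]]] ?] // _;
    apply: val_inj.
rewrite [RHS]mxE !mxtens_indexK !mxE.
by case: i => [[|[|[|[|[]]]]] ?] //; case: j => [[|[|[|[|[]]]]] ?] //;
  rewrite !(tnth_nth (0, 0)) /=; ring.
Qed.

(** * Assembling the spectrum, then descent to the integers *)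

Lemma epg_char_poly_closed (C : numClosedFieldType) p q n m
  (aT bT gT : finGroupType)
  (A : {group aT}) (B : {group bT}) (G : {group gT}) :
  prime p -> prime q -> p <> q -> (0 < n)%N -> (0 < m)%N ->
  is_El p n A -> is_El q m B -> G \isog setX A B ->
  adj_char_poly C (enhanced_power_graph G) =
    epg_poly C p q n m ((p ^ n - 1) %/ (p - 1)) ((q ^ m - 1) %/ (q - 1)).
Proof.
move=> hp hq /eqP hpq hn hm [abA cardA] [abB cardB] isoG.
have p_gt1 := prime_gt1 hp; have q_gt1 := prime_gt1 hq.
have [k eN chA] := char_poly_cocyclic_abelem C hp hn abA cardA.
have [l eM chB] := char_poly_cocyclic_abelem C hq hm abB cardB.
have -> : ((p ^ n - 1) %/ (p - 1) = k.+1)%N by rewrite eN mulnK ?subn_gt0.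
have -> : ((q ^ m - 1) %/ (q - 1) = l.+1)%N by rewrite eM mulnK ?subn_gt0.
have coAB : coprime #|A| #|B|.
  rewrite cardA cardB coprime_pexpl // coprime_pexpr //.
  by rewrite prime_coprime // dvdn_prime2.
rewrite /adj_char_poly adjacency_enhanced_power_graph char_poly_subr1.
rewrite (char_poly_cocyclic_mx_setX _ coAB isoG).
(* The number [u] of zeros listed for [J(A)] is kept opaque; with [k] copies of [p - 1] and two
   roots of the quadratic it makes up [p^n] eigenvalues. Likewise [v] for [J(B)]. *)
have [u eu] : exists u, (u = p ^ n - 1 - k.+1)%N by eexists.
have [v ev] : exists v, (v = q ^ m - 1 - l.+1)%N by eexists.
have epn : (p ^ n = u + k.+2)%N.
  rewrite eu addnS subnK ?subn1 ?prednK ?expn_gt0 ?prime_gt0 //.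
  by rewrite -subn1 eN leq_pmulr ?subn_gt0.
have eqm : (q ^ m = v + l.+2)%N.
  rewrite ev addnS subnK ?subn1 ?prednK ?expn_gt0 ?prime_gt0 //.
  by rewrite -subn1 eM leq_pmulr ?subn_gt0.
rewrite -eu in chA; rewrite -ev in chB.
rewrite !natrB ?natrX ?expn_gt0 ?prime_gt0 // in chA chB.
set d := p%:R - 1 in chA; set N := p%:R ^+ n - 1 in chA.
set e := q%:R - 1 in chB; set M := q%:R ^+ m - 1 in chB.
have [a1 [a2 [sa ta]]] := quadratic_roots (1 + d) (d - N).
have [b1 [b2 [sb tb]]] := quadratic_roots (1 + e) (e - M).
have chT : char_poly (T1 C p q n m) =
    (\prod_(a <- [:: a1; a2]) \prod_(b <- [:: b1; b2]) ('X - (a * b)%:P))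
    \Po ('X + 1).
  rewrite char_poly_T1 -/d -/e -/N -/M; congr (_ \Po _).
  apply: char_poly_tensmx => //; rewrite char_poly_mx22 !mxE /= !big_cons big_nil.
    by rewrite !mulr1 polyC1 (quadratic_factor sa ta).
  by rewrite !mulr1 polyC1 (quadratic_factor sb tb).
(* [Mf + 1] is [d] times [quotient_mx e M], hence has eigenvalues [d * b1] and [d * b2]. *)
have chF : char_poly (Mf C p q m) =
    (('X - (d * b1)%:P) * ('X - (d * b2)%:P)) \Po ('X + 1).
  rewrite char_poly_mx22 !mxE /= comp_polyM !comp_polyB !comp_polyX !comp_polyC.
  have eM' : M = e - b1 * b2 by rewrite tb; ring.
  have ee : e = b1 + b2 - 1 by rewrite sb; ring.
  rewrite -/e -/M -/d eM' ee (_ : p%:R - 2 = d - 1); last by rewrite /d; ring.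
  by rewrite !(rmorphD, rmorphN, rmorphM, rmorph1); ring.
(* [Mg + 1] is [e] times [quotient_mx d N] with its two indices exchanged. *)
have chG : char_poly (Mg C p q n) =
    (('X - (a1 * e)%:P) * ('X - (a2 * e)%:P)) \Po ('X + 1).
  rewrite char_poly_mx22 !mxE /= comp_polyM !comp_polyB !comp_polyX !comp_polyC.
  have eN' : N = d - a1 * a2 by rewrite ta; ring.
  have ed : d = a1 + a2 - 1 by rewrite sa; ring.
  rewrite -/e -/N -/d eN' ed (_ : q%:R - 2 = e - 1); last by rewrite /e; ring.
  by rewrite !(rmorphD, rmorphN, rmorphM, rmorph1); ring.
rewrite (char_poly_tensmx (s := nseq u 0 ++ nseq k d ++ [:: a1; a2])
  (t := nseq v 0 ++ nseq l e ++ [:: b1; b2])); first last.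
- rewrite chB (quadratic_factor sb tb) !big_cat !big_nseq !iter_mulr_1 /=.
  by rewrite !big_cons big_nil subr0 mulr1 mulrA.
- rewrite chA (quadratic_factor sa ta) !big_cat !big_nseq !iter_mulr_1 /=.
  by rewrite !big_cons big_nil subr0 mulr1 mulrA.
- by rewrite card_subg.
- by rewrite card_subg.
rewrite prod_XsubC_pairs !rmorphM !rmorphXn /=.
rewrite /epg_poly chT chF chG !subn1 /= comp_polyX.
have -> : (p ^ n * q ^ m - (k.+1 + 1) * (l.+1 + 1) = u * (v + l.+2) + k.+2 * v)%N.
  by rewrite epn eqm !addn1 mulnDl [in X in (_ + X - _)%N]mulnDr addnA addnK.
(* This is [(X + 1) - (p - 1)(q - 1)] expanded. *)
have -> : 'X - (p * q)%:R%:P + p%:R%:P + q%:R%:P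
    = ('X - (d * e)%:P) \Po ('X + 1) :> {poly C}.
  rewrite comp_polyB comp_polyX comp_polyC /d /e natrM.
  by rewrite !(rmorphD, rmorphN, rmorphM, rmorph1); ring.
by rewrite !rmorphM.
Qed.

Theorem theorem4p16 (R : numDomainType) (p q n m : nat)
  (aT bT gT : finGroupType)
  (A : {group aT}) (B : {group bT}) (G : {group gT})
  (hp : prime p) (hq : prime q) (hpq : p <> q)
  (hn : (0 < n)%N) (hm : (0 < m)%N)
  (hA : is_El p n A) (hB : is_El q m B) (hG : G \isog setX A B) :
  let alpha := ((p ^ n - 1) %/ (p - 1))%N in
  let beta := ((q ^ m - 1) %/ (q - 1))%N in
  let f := char_poly (Mf R p q m) in
  let g := char_poly (Mg R p q n) in
  adj_char_poly R (enhanced_power_graph G) =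
    char_poly (T1 R p q n m)
    * ('X + 1) ^+ (p ^ n * q ^ m - (alpha + 1) * (beta + 1))
    * ('X - (p * q)%:R%:P + p%:R%:P + q%:R%:P) ^+ ((alpha - 1) * (beta - 1))
    * f ^+ (alpha - 1) * g ^+ (beta - 1).
Proof.
rewrite /= -/(epg_poly R p q n m _ _) -(map_adj_char_poly (intr : {rmorphism int -> R})).
rewrite -(map_epg_poly (intr : {rmorphism int -> R})); congr (map_poly _ _).
(* The remaining identity is over [int], which embeds in [algC]. *)
apply: (map_inj_poly (@intr_inj algC)); first by [].
rewrite map_adj_char_poly map_epg_poly.
exact: epg_char_poly_closed hp hq hpq hn hm hA hB hG.
Qed.
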